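(* Let $G$ be a unicyclic graph which is not itself a cycle, and let $C$ be the cycle of $G$. Then $G$ is singular if and only if at least one of the following holds: (i) there is a vertex $v\in V(C)$ such that $v\notin Supp(G\{v\})$ and, moreover, $G\{v\}$ does not have a perfect matching or $G-G\{v\}$ does not have a perfect matching; (ii) every vertex $v\in V(C)$ satisfies $v\in Supp(G\{v\})$ and, moreover, at least one of the trees (connected components) composing the forest $G-C$ does not have a perfect matching or the length of the cycle $C$ is a multiple of $4$.
   Context: All graphs are finite and simple. A unicyclic graph is a connected graph containing exactly one cycle. $A(G)$ is the adjacency matrix of $G$ and $\mathcal{N}(G)=\{x\in\mathbb{R}^{V(G)}: A(G)x=0\}$ is its null space. $G$ is singular if $A(G)$ is a singular matrix, i.e. $\mathcal{N}(G)\neq\{0\}$. The support of $G$ is $Supp(G)=\{v\in V(G): x_v\neq 0 \text{ for some } x\in\mathcal{N}(G)\}$. For a subgraph $H$ of $G$, $G-H$ is the subgraph of $G$ induced by $V(G)\setminus V(H)$. For a unicyclic graph $G$ with cycle $C$ and $v\in V(C)$, the pendant tree $G\{v\}$ of $G$ at $v$ is the induced connected subgraph of $G$ with the maximum possible number of vertices which contains $v$ and no other vertex of $C$ (it may consist of $v$ alone). A matching is a set of pairwise non-adjacent edges; it is perfect if every vertex is an endpoint of one of its edges. *)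

(* Defs.v *)
From mathcomp Require Import all_boot all_order all_algebra.
From mathcomp Require Import reals.

Set Implicit Arguments.
Unset Strict Implicit.
Unset Printing Implicit Defensive.

Import GRing.Theory.

(** A finite simple graph on vertices drawn from an ambient finite type, so
    that a graph and all its subgraphs share one type.  Edges are two-element
    sets; the axiom is boolean, so two graphs with the same vertices and edges
    are Leibniz-equal. *)
Record graph (T : finType) := Graph {
  vertices : {set T};
  edges : {set {set T}};
  edgesP : [forall f in edges, (f \subset vertices) && (#|f| == 2)]
}.

Section Graphs.
Variable T : finType.
Implicit Types (G H K C : graph T) (S : {set T}) (M : {set {set T}}).

Definition adj G : rel T := [rel x y | [set x; y] \in edges G].

Definition subgraph H G : bool :=
  (vertices H \subset vertices G) && (edges H \subset edges G).

Lemma induced_edgesP G S :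
  [forall f in [set f in edges G | f \subset S],
    (f \subset vertices G :&: S) && (#|f| == 2)].
Proof.
apply/forall_inP => f; rewrite inE => /andP[fG fS].
by have /andP[fV ->] := forall_inP (edgesP G) f fG; rewrite subsetI fV fS.
Qed.

Definition induced G S : graph T := Graph (induced_edgesP G S).

Definition delete G H : graph T := induced G (vertices G :\: vertices H).

Definition connected_graph G : bool :=
  (vertices G != set0) &&
  [forall x in vertices G, forall y in vertices G, connect (adj G) x y].

Definition is_component K G : Prop :=
  [/\ subgraph K G, connected_graph K &
      forall H, subgraph H G -> connected_graph H -> subgraph K H -> H = K].

Definition is_cycle C : Prop :=
  exists c : seq T,
    [/\ uniq c, 3 <= size c, vertices C = [set x in c] &
        edges C = [set [set x; next c x] | x in c]].

Definition cycle_of C G : Prop := is_cycle C /\ subgraph C G.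

Definition unicyclic G : Prop :=
  connected_graph G /\ exists! C, cycle_of C G.

(** Meaningful for [v \in vertices C] with [C] a subgraph of [G]: then [[set v]]
    is admissible, and the maximiser is unique because the union of two
    admissible sets is admissible. *)
Definition pendant_tree G C (v : T) : graph T :=
  induced G
    [arg max_(S > [set v] |
       [&& S \subset vertices G, connected_graph (induced G S) &
           S :&: vertices C == [set v]]) #|S|].

Definition has_perfect_matching G : Prop :=
  exists M, [/\ M \subset edges G, trivIset M & cover M = vertices G].

End Graphs.

Section Spectral.
Local Open Scope ring_scope.
Variables (R : realType) (T : finType).
Implicit Types G : graph T.

Definition adjacency G : 'M[R]_#|vertices G| :=
  \matrix_(i, j) (adj G (enum_val i) (enum_val j))%:R.

Definition in_null_space G (x : 'cV[R]_#|vertices G|) : Prop :=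
  adjacency G *m x = 0.

Definition singular_graph G : Prop := adjacency G \notin unitmx.

Definition in_support G (v : T) : Prop :=
  exists x : 'cV[R]_#|vertices G|,
    in_null_space x /\
    exists i : 'I_#|vertices G|, enum_val i = v /\ x i 0 != 0.

End Spectral.

(* Main.v *)
Require Import Defs.
From mathcomp Require Import all_boot all_order all_algebra.
From mathcomp Require Import boolp reals.

(** Vectors on a set of vertices are functions, and [singular_on], [support_on]
    refer to the adjacency relation restricted to that set.  If some cycle vertex
    [v] is outside the support of its pendant tree [P], the unit vector at [v] is
    the image under the adjacency matrix of [P] of a vector vanishing at [v]; hence
    [G] is singular iff [P] or [G - P] is, and both are forests.  If every cycle
    vertex is in the support of its pendant tree, pairing with null vectors of the
    pendant trees shows that [G] is singular iff the cycle or the forest [G - C]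
    is.  A forest is nonsingular iff it has a perfect matching, by removing a leaf
    and its neighbour, and a cycle is singular iff its length is a multiple of 4. *)

Set Implicit Arguments.
Unset Strict Implicit.
Unset Printing Implicit Defensive.

Import GRing.Theory Num.Theory.

Local Open Scope ring_scope.

(** * Null vectors on a set of vertices *)

Section NullVectors.
Variables (F : fieldType) (T : finType) (a : rel T).
Implicit Types (S P Q : {set T}) (x y z : T -> F) (u v w : T).

Definition adjsum S x u : F := \sum_(w in S) (a u w)%:R * x w.

Definition null_on S x := forall u, u \in S -> adjsum S x u = 0.

Definition singular_on S :=
  exists x, null_on S x /\ exists2 u, u \in S & x u != 0.

(** Meaningful for [v \in S]: the values of a null vector outside [S] are unconstrained. *)
Definition support_on S v := exists2 x, null_on S x & x v != 0.

Definition adjmx S : 'M[F]_#|S| :=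
  \matrix_(i, j) (a (enum_val i) (enum_val j))%:R.

Lemma fun_of_col S (X : 'cV[F]_#|S|) :
  exists x : T -> F, forall i, x (enum_val i) = X i 0.
Proof.
(* Extension by zero outside [S], written as a sum because an index for [w] is available only when
   [w \in S]. *)
exists (fun w => \sum_(j < #|S|) (enum_val j == w)%:R * X j 0) => i.
rewrite (bigD1 i) //= eqxx mul1r big1 ?addr0 // => j ji.
by rewrite (inj_eq enum_val_inj) (negbTE ji) mul0r.
Qed.

Lemma mul_adjmx S (X : 'cV[F]_#|S|) x i :
  (forall i, x (enum_val i) = X i 0) ->
  (adjmx S *m X) i 0 = adjsum S x (enum_val i).
Proof.
move=> xX; rewrite mxE /adjsum [RHS]big_enum_val.
by apply: eq_bigr => j _; rewrite mxE xX.
Qed.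

Lemma null_adjmx S (X : 'cV[F]_#|S|) x :
  (forall i, x (enum_val i) = X i 0) -> adjmx S *m X = 0 <-> null_on S x.
Proof.
move=> xX; split=> [X0 u uS | x0].
  by rewrite -(enum_rankK_in uS uS) -(mul_adjmx _ xX) X0 mxE.
apply/matrixP => i j; rewrite (ord1 j) (mul_adjmx _ xX) mxE.
exact/x0/enum_valP.
Qed.

Lemma adjmx_supportP S v : v \in S ->
  (exists X : 'cV[F]_#|S|, adjmx S *m X = 0 /\
     exists i : 'I_#|S|, enum_val i = v /\ X i 0 != 0)
  <-> support_on S v.
Proof.
move=> vS; split=> [[X [X0 [i [<- Xi]]]] | [x x0 xv]].
  have [x xX] := fun_of_col X; exists x; first exact/(null_adjmx xX).
  by rewrite xX.
have xX i : x (enum_val i) = (\col_(i < #|S|) x (enum_val i)) i 0.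
  by rewrite mxE.
exists (\col_i x (enum_val i)); split; first exact/(null_adjmx xX).
by exists (enum_rank_in vS v); rewrite -xX enum_rankK_in.
Qed.

Lemma adjmx_singularP S : adjmx S \notin unitmx <-> singular_on S.
Proof.
split=> [nU | [x [x0 [v vS xv]]]].
  (* A singular matrix has a nonzero cokernel matrix, and every column of that matrix is a null
     vector. *)
  have : cokermx (adjmx S) != 0.
    by rewrite -mxrank_eq0 mxrank_coker subn_eq0 -ltnNge ltn_neqAle
      rank_leq_row andbT -row_free_unit in nU *.
  move=> /matrix0Pn[i [j Mij]].
  have [x xX] := fun_of_col (col j (cokermx (adjmx S))).
  exists x; split; last by exists (enum_val i); rewrite ?enum_valP // xX mxE.
  apply/(null_adjmx xX); by rewrite colE mulmxA mulmx_coker mul0mx.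
have [X [X0 [i [_ /negP Xi]]]] : exists X : 'cV[F]_#|S|, adjmx S *m X = 0 /\
     exists i : 'I_#|S|, enum_val i = v /\ X i 0 != 0.
  by apply/(adjmx_supportP vS); exists x.
by apply/negP => U; apply: Xi; rewrite -(mulKmx U X) X0 mulmx0 mxE.
Qed.

Hypothesis aC : symmetric a.

Lemma adjsum_sym S x y :
  \sum_(u in S) adjsum S x u * y u = \sum_(u in S) adjsum S y u * x u.
Proof.
rewrite /adjsum; under eq_bigr do rewrite big_distrl.
rewrite exchange_big /=; apply: eq_bigr => u _; rewrite big_distrl /=.
by apply: eq_bigr => w _ /=; rewrite aC mulrAC.
Qed.

(* The row space of the symmetric matrix [adjmx S] is the orthogonal of its
   kernel. *)
Lemma delta_adjsum S v : v \in S -> ~ support_on S v ->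
  exists y, forall u, u \in S -> adjsum S y u = (u == v)%:R.
Proof.
move=> vS nsv; pose i0 := enum_rank_in vS v.
have vi0 : enum_val i0 = v by rewrite enum_rankK_in.
have : ((delta_mx 0 i0 : 'rV[F]_#|S|) <= adjmx S)%MS.
  rewrite submxE; apply/eqP/matrixP => k j; rewrite (ord1 k) {k} -rowE [LHS]mxE [RHS]mxE.
  apply: contrapT => /eqP Mij; apply: nsv; apply: (iffLR (adjmx_supportP vS)).
  exists (col j (cokermx (adjmx S))); split; last by exists i0; rewrite mxE.
  by rewrite colE mulmxA mulmx_coker mul0mx.
case/submxP => D eD.
have [y yD] := fun_of_col D^T; exists y => u uS.
rewrite -(enum_rankK_in uS uS) -(mul_adjmx _ yD).
set i := enum_rank_in uS u.
have -> : adjmx S = (adjmx S)^T by apply/matrixP => ? ?; rewrite !mxE aC.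
by rewrite -trmx_mul -eD !mxE /= -(inj_eq enum_val_inj) vi0.
Qed.

Lemma adjsum_setD S P x u : P \subset S ->
  adjsum S x u = adjsum P x u + adjsum (S :\: P) x u.
Proof.
move=> PS; rewrite /adjsum (big_setID P) /=.
by rewrite (setIidPr PS).
Qed.

Lemma eq_adjsum S x y u : (forall w, w \in S -> x w = y w) ->
  adjsum S x u = adjsum S y u.
Proof. by move=> xy; apply: eq_bigr => w /xy ->. Qed.

Lemma adjsum_eq0 S x u : (forall w, w \in S -> a u w -> x w = 0) ->
  adjsum S x u = 0.
Proof.
move=> x0; apply: big1 => w wS; case auw: (a u w); last by rewrite mul0r.
by rewrite x0 // mulr0.
Qed.

Lemma adjsum_lin S x y c u :
  adjsum S (fun w => x w + c * y w) u = adjsum S x u + c * adjsum S y u.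
Proof.
rewrite /adjsum big_distrr -big_split; apply: eq_bigr => w _ /=.
by rewrite mulrDr !mulrA [_ * c]mulrC.
Qed.

Lemma adjsum1 S v x u : v \in S -> (forall w, w \in S -> a u w -> w != v -> x w = 0) ->
  adjsum S x u = (a u v)%:R * x v.
Proof.
move=> vS x0; rewrite /adjsum (bigD1 v) //= big1 ?addr0 // => w /andP[wS wv].
by case auw: (a u w); rewrite ?mul0r // x0 // mulr0.
Qed.

Lemma eq_adjsum_nbr S P x u : (forall w, a u w -> (w \in S) = (w \in P)) ->
  adjsum S x u = adjsum P x u.
Proof.
move=> SP; rewrite /adjsum big_mkcond [RHS]big_mkcond; apply: eq_bigr => w _.
case auw: (a u w); first by rewrite SP.
by rewrite mul0r !if_same.
Qed.

Lemma adjsum_supported S P x u : P \subset S ->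
  (forall w, w \in S :\: P -> x w = 0) -> adjsum S x u = adjsum P x u.
Proof.
move=> PS x0; rewrite (adjsum_setD _ _ PS) (adjsum_eq0 (S := S :\: P)) ?addr0 //.
by move=> w /x0.
Qed.

(* Since [v] lies outside the support, the unit vector at [v] is the image of
   some [y]; the colouring lets [y] vanish at [v], which decouples [P] from
   [S :\: P]. *)
Lemma singular_on_split_unsupported S P v (col : T -> bool) :
  P \subset S -> v \in P ->
  (forall u w, u \in P -> w \in S :\: P -> a u w -> u = v) ->
  (forall u w, u \in P -> w \in P -> a u w -> col u != col w) ->
  ~ support_on P v ->
  singular_on S <-> singular_on P \/ singular_on (S :\: P).
Proof.
move=> PS vP bd colP nsv.
have [y [ey yv]] : exists y,
    (forall u, u \in P -> adjsum P y u = (u == v)%:R) /\ y v = 0.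
  have [y ey] := delta_adjsum vP nsv.
  (* Clear [y] on the colour class of [v]. An equation at a vertex of that class involves only the
     other class and is unchanged; an equation at any other vertex involves only cleared values and
     reads 0 = 0. *)
  exists (fun w => if col w == col v then 0 else y w); split; last by rewrite eqxx.
  move=> u uP; have [cuv|cuv] := eqVneq (col u) (col v).
    rewrite -(ey _ uP); apply: eq_bigr => w wP; case auw: (a u w); rewrite ?mul0r //.
    by have := colP _ _ uP wP auw; rewrite cuv eq_sym => /negbTE ->.
  rewrite adjsum_eq0; first by case: (eqVneq u v) cuv => [->|]; rewrite ?eqxx.
  move=> w wP auw; have := colP _ _ uP wP auw.
  by case: (col u) (col v) (col w) cuv => [] [] [].
have outP u w : u \in P -> u != v -> w \in S :\: P -> a u w -> False.
  by move=> uP uv wQ auw; rewrite (bd _ _ uP wQ auw) eqxx in uv.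
have QP x u : x v = 0 -> u \in S :\: P -> adjsum P x u = 0.
  move=> xv uQ; apply: adjsum_eq0 => w wP auw.
  by rewrite (bd w u) // aC.
have PQ x u : u \in P -> adjsum (S :\: P) x u = adjsum (S :\: P) x v * (u == v)%:R.
  move=> uP; case: eqVneq => [->|uv]; rewrite ?mulr1 // mulr0.
  by apply: adjsum_eq0 => w wQ /(outP _ _ uP uv wQ).
have QS u : u \in S :\: P -> u \in S by rewrite inE => /andP[].
split=> [[x [x0 [u uS xu]]]|].
  (* The outside acts on [P] only at [v], with total [s], so [x + s * y] is null on [P]. As
     [y v = 0], its value at [v] is [x v], which must therefore vanish. *)
  pose s := adjsum (S :\: P) x v.
  have z0 : null_on P (fun w => x w + s * y w).
    move=> w wP; rewrite adjsum_lin ey // -PQ // -(adjsum_setD x w PS).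
    exact/x0/(subsetP PS).
  have xv : x v = 0.
    apply/eqP/negPn/negP => xv; apply: nsv; exists (fun w => x w + s * y w) => //.
    by rewrite yv mulr0 addr0.
  have [[w wQ xw]|nQ] := EM (exists2 w, w \in S :\: P & x w != 0).
    right; exists x; split; last by exists w.
    move=> t tQ; rewrite -(x0 t (QS _ tQ)) (adjsum_setD x t PS) QP ?add0r //.
  have xQ w : w \in S :\: P -> x w = 0.
    by move=> wQ; apply/eqP/negPn/negP => xw; apply: nQ; exists w.
  left; exists x; split=> [w wP|].
    by rewrite -(adjsum_supported w PS xQ) x0 // (subsetP PS).
  exists u => //; apply/negPn/negP => uP.
  by rewrite xQ ?eqxx // inE uP in xu.
case=> -[x [x0 [u uP xu]]].
  have xv : x v = 0.
    by apply/eqP/negPn/negP => xv; apply: nsv; exists x.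
  pose x' w := if w \in P then x w else 0.
  have x'P w : w \in P -> x w = x' w by rewrite /x' => ->.
  exists x'; split; last by exists u; rewrite ?(subsetP PS) // -x'P.
  move=> w wS; rewrite (adjsum_supported w PS); last first.
    by move=> t; rewrite inE /x' => /andP[/negbTE ->].
  rewrite -(eq_adjsum w x'P).
  by have [wP|wP] := boolP (w \in P); [exact: x0 | rewrite QP // inE wP].
pose s := adjsum (S :\: P) x v.
(* Inside [P], the multiple [- s] of [y] cancels the contribution [s] of the outside at [v]; since
   [y v = 0], the equations outside [P] are untouched. The summand 0 gives the shape of
   [adjsum_lin]. *)
pose x' w := if w \in P then 0 + (- s) * y w else x w.
have x'P w : w \in P -> x' w = 0 + (- s) * y w by rewrite /x' => ->.
have x'Q w : w \in S :\: P -> x' w = x w by rewrite /x' inE => /andP[/negbTE ->].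
exists x'; split; last by exists u; rewrite ?QS // x'Q.
move=> w wS; rewrite (adjsum_setD x' w PS) (eq_adjsum w x'P) (eq_adjsum w x'Q).
rewrite adjsum_lin (adjsum_eq0 (x := fun=> 0)) // add0r.
have [wP|wP] := boolP (w \in P); first by rewrite ey // PQ // mulNr addNr.
by rewrite QP ?x0 ?mulr0 ?addr0 // inE wP.
Qed.

(** Scaling to 1 at [v] and vanishing off [P] let such a vector be summed over any larger set. *)
Lemma support_on_normalized P v : v \in P -> support_on P v ->
  exists z, [/\ null_on P z, z v = 1 & forall w, w \notin P -> z w = 0].
Proof.
move=> vP [x x0 xv]; exists (fun w => if w \in P then 0 + (x v)^-1 * x w else 0).
split=> [u uP||w /negbTE -> //]; last by rewrite vP add0r mulVf.
rewrite (eq_adjsum (y := fun w => 0 + (x v)^-1 * x w)); last by move=> w ->.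
by rewrite adjsum_lin x0 // mulr0 addr0 adjsum_eq0.
Qed.

(* Pairing a null vector with a null vector of [P v] that is nonzero at [v]
   decouples the vertices of [C] from the rest of the graph. *)
Lemma singular_on_split_supported S (C : {set T}) (P : T -> {set T}) :
  irreflexive a -> C \subset S ->
  (forall v, v \in C -> P v \subset S) ->
  (forall v, v \in C -> P v :&: C = [set v]) ->
  (forall v u w, v \in C -> u \in P v -> w \in S :\: P v -> a u w ->
     u = v /\ w \in C) ->
  (forall v, v \in C -> support_on (P v) v) ->
  singular_on S <-> singular_on C \/ singular_on (S :\: C).
Proof.
move=> aI CS PS PC bd supp.
have vP v : v \in C -> v \in P v.
  by move=> /PC/setP/(_ v); rewrite !inE eqxx => /andP[].
have PCv v u : v \in C -> u \in P v -> u \in C -> u = v.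
  by move=> /PC/setP/(_ u); rewrite !inE => e uP uC; apply/eqP; rewrite -e uP.
have /choice[z zP] : forall v, exists z, v \in C ->
    [/\ null_on (P v) z, z v = 1 & forall w, w \notin P v -> z w = 0].
  move=> v.
  have [vC|] := boolP (v \in C); last by exists (fun=> 0).
  by have [z ?] := support_on_normalized (vP _ vC) (supp _ vC); exists z.
have nbrC v w : v \in C -> a v w -> (w \in S :\: P v) = (w \in C).
  move=> vC avw; apply/idP/idP => [wQ|wC].
    by have [] := bd _ _ _ vC (vP _ vC) wQ avw.
  rewrite inE (subsetP CS) // andbT; apply/negP => wP.
  by rewrite (PCv _ _ vC wP wC) aI in avw.
split=> [[x [x0 [u uS xu]]]|].
  have xC : null_on C x.
    move=> v vC; have [z0 zv _] := zP _ vC.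
    rewrite -(eq_adjsum_nbr _ (fun w => @nbrC v w vC)).
    (* Pair the equations on [P v] with [z v]. By symmetry the part inside [P v] vanishes, and the
       part leaving [P v] survives only at [v], where [z v] is 1: what remains is the equation of
       the cycle at [v]. *)
    have : \sum_(u in P v) adjsum S x u * z v u = 0.
      by apply: big1 => w wP; rewrite x0 ?mul0r // (subsetP (PS _ vC)).
    under eq_bigr do rewrite (adjsum_setD _ _ (PS _ vC)) mulrDl.
    rewrite big_split /= adjsum_sym big1 ?add0r; last first.
      by move=> w wP; rewrite z0 // mul0r.
    rewrite (bigD1 v) ?vP //= zv mulr1 big1 ?addr0 // => w /andP[wP wv].
    rewrite adjsum_eq0 ?mul0r // => t tQ awt.
    by have [wv'] := bd _ _ _ vC wP tQ awt; rewrite wv' eqxx in wv.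
  have [[w wC xw]|nC] := EM (exists2 w, w \in C & x w != 0).
    by left; exists x; split; last by exists w.
  have x0C w : w \in C -> x w = 0.
    by move=> wC; apply/eqP/negPn/negP => xw; apply: nC; exists w.
  right; exists x; split=> [w|].
    rewrite inE => /andP[wC wS]; rewrite -(x0 w wS) (adjsum_setD x w CS).
    by rewrite [adjsum C x w]adjsum_eq0 ?add0r // => t /x0C.
  exists u; rewrite // inE uS andbT; apply/negP => uC.
  by rewrite x0C ?eqxx in xu.
case=> -[x [x0 [u uC xu]]].
  (* The null vector of the cycle is propagated by attaching to each [v] the multiple [x v] of the
     normalized null vector of [P v]. *)
  pose x' w := \sum_(v in C) x v * z v w.
  have x'C w : w \in C -> x' w = x w.
    move=> wC; rewrite /x' (bigD1 w) //=; have [_ -> _] := zP _ wC.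
    rewrite mulr1 big1 ?addr0 // => v /andP[vC vw]; have [_ _ ->] := zP _ vC.
      by rewrite mulr0.
    by apply/negP => wP; rewrite (PCv _ _ vC wP wC) eqxx in vw.
  exists x'; split; last by exists u; rewrite ?(subsetP CS) // x'C.
  move=> w wS.
  have -> : adjsum S x' w = \sum_(v in C) x v * adjsum S (z v) w.
    rewrite /adjsum; under eq_bigr do rewrite big_distrr.
    rewrite exchange_big; apply: eq_bigr => v _ /=; rewrite big_distrr /=.
    by apply: eq_bigr => t _; rewrite mulrCA.
  have zS v : v \in C -> adjsum S (z v) w = adjsum (P v) (z v) w.
    move=> vC; apply: adjsum_supported (PS _ vC) _ => t.
    by have [_ _ zo] := zP _ vC; rewrite inE => /andP[/zo].
  have zw v : v \in C -> w \notin P v -> adjsum S (z v) w = (a w v)%:R.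
    move=> vC wP; rewrite zS // (@adjsum1 _ v); first by have [_ -> _] := zP _ vC; rewrite mulr1.
      exact: vP.
    move=> t tP awt tv; have [] := bd v t w vC tP; rewrite ?inE ?wP // 1?aC //.
    by move=> tv'; rewrite tv' eqxx in tv.
  have [wC|wC] := boolP (w \in C).
    rewrite -[RHS](x0 w wC) /adjsum; apply: eq_bigr => v vC; rewrite mulrC.
    congr (_ * _); have [wP|wP] := boolP (w \in P v); last exact: zw.
    have [z0 _ _] := zP _ vC; rewrite [LHS]zS // z0 //.
    by rewrite (PCv _ _ vC wP wC) aI.
  apply: big1 => v vC; have [wP|wP] := boolP (w \in P v).
    by have [z0 _ _] := zP _ vC; rewrite zS // z0 // mulr0.
  rewrite zw //; case awv: (a w v); rewrite ?mulr0 //.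
  have [] := bd v v w vC (vP _ vC); rewrite ?inE ?wP // 1?aC //.
  by rewrite (negbTE wC).
pose x' w := if w \in C then 0 else x w.
have x'F w : w \in S :\: C -> x' w = x w by rewrite /x' inE => /andP[/negbTE ->].
have x'0 w : w \in C -> x' w = 0 by rewrite /x' => ->.
have uS : u \in S by move: uC; rewrite inE => /andP[].
exists x'; split; last by exists u; rewrite ?x'F.
move=> v vS; rewrite (adjsum_setD x' v CS) (adjsum_eq0 (S := C)) ?add0r; last first.
  by move=> w /x'0.
rewrite (eq_adjsum v x'F).
have [vC|vC] := boolP (v \in C); last by rewrite x0 // inE vC.
have [z0 zv zo] := zP _ vC.
(* The equation at a cycle vertex [v] comes from pairing with [z v] again. At [w] off the cycle,
   [z v] sums to 0 over all of [S], and its part on [C] is [a w v]; hence its part off [C] is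
   [- a w v], and the pairing is the desired sum up to sign. *)
have : \sum_(w in S :\: C) adjsum (S :\: C) x w * z v w = 0.
  by apply: big1 => w wF; rewrite x0 // mul0r.
rewrite adjsum_sym => e; apply/eqP; rewrite -oppr_eq0 -[X in _ == X]e; apply/eqP.
rewrite /adjsum -sumrN.
apply: eq_bigr => w; rewrite inE => /andP[wC wS].
rewrite -[\sum_(t in _) _]/(adjsum (S :\: C) (z v) w) -mulNr; congr (_ * _).
have : adjsum S (z v) w = (w \notin P v)%:R * (a w v)%:R.
  rewrite (adjsum_supported w (PS _ vC)); last first.
    by move=> t; rewrite inE => /andP[/zo].
  have [wP|wP] := boolP (w \in P v); first by rewrite z0 // mul0r.
  rewrite mul1r (@adjsum1 _ v) ?vP // ?zv ?mulr1 // => t tP awt tv.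
  have [] := bd v t w vC tP; rewrite ?inE ?wP // 1?aC //.
  by move=> tv'; rewrite tv' eqxx in tv.
have -> : (w \notin P v)%:R * (a w v)%:R = 0 :> F.
  have [wP|wP] := boolP (w \in P v); first by rewrite mul0r.
  case awv: (a w v); rewrite ?mulr0 //.
  have [] := bd v v w vC (vP _ vC); rewrite ?inE ?wP // 1?aC //.
  by rewrite (negbTE wC).
rewrite (adjsum_setD _ _ CS) (@adjsum1 _ v) // ?zv ?mulr1.
  by rewrite aC => /eqP; rewrite addrC addr_eq0 => /eqP ->.
move=> t tC _ tv; rewrite zo //; apply/negP => tP.
by rewrite (PCv _ _ vC tP tC) eqxx in tv.
Qed.

End NullVectors.

(** * Acyclic sets of vertices *)

Section Acyclic.
Variables (F : fieldType) (T : finType) (a : rel T).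
Hypotheses (aC : symmetric a) (aI : irreflexive a).
Implicit Types (S : {set T}) (u v w : T).

(** Acyclicity in the form used by leaf removal: each nonempty induced subgraph has a vertex of
    degree at most 1. *)
Definition acyclic_on S := forall S', S' \subset S -> S' != set0 ->
  exists2 u, u \in S' & (#|[set w in S' | a u w]| <= 1)%N.

(** A perfect matching encoded as the involution sending each vertex to its partner. *)
Definition matching_on S :=
  exists f : T -> T, forall u, u \in S -> [/\ f u \in S, a u (f u) & f (f u) = u].

Lemma acyclic_on_sub S S' : S' \subset S -> acyclic_on S -> acyclic_on S'.
Proof. by move=> sS' ac S1 sS1; apply/ac/(subset_trans sS1). Qed.

Lemma acyclic_on_colouring S : acyclic_on S ->
  exists col : T -> bool,
    forall u w, u \in S -> w \in S -> a u w -> col u != col w.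
Proof.
have [n] := ubnP #|S|; elim: n S => // n IH S ltS ac.
have [->|S0] := eqVneq S set0; first by exists xpredT => u w; rewrite inE.
have [u uS deg] := ac S (subxx _) S0.
have [||col colP] := IH (S :\ u).
- by move: ltS; rewrite (cardsD1 u S) uS add1n ltnS.
- exact: acyclic_on_sub (subsetDl _ _) ac.
(* The colour of the only neighbour of [u] in [S], or [false] if there is none; [u] receives the
   opposite colour. *)
pose b := [exists w in S, a u w && col w].
have bP w : w \in S -> a u w -> col w = b.
  move=> wS auw; apply/idP/exists_inP => [cw|[w' w'S /andP[auw' cw']]].
    by exists w; rewrite ?auw.
  suff -> : w = w' by [].
  by apply: (card_le1_eqP deg); rewrite !inE ?wS ?w'S.
exists (fun w => if w == u then ~~ b else col w) => x y xS yS axy.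
have [exu|xu] := eqVneq x u; have [eyu|yu] := eqVneq y u.
- by rewrite exu eyu aI in axy.
- by rewrite (bP y) -?exu //; case: (b).
- by rewrite (bP x) // -?eyu 1?aC //; case: (b).
- by apply: colP; rewrite ?inE ?xu ?yu.
Qed.

(** By induction on the size. An isolated vertex gives a null vector and prevents a perfect
    matching. If [u] is a leaf with neighbour [w], deleting both changes neither singularity nor the
    existence of a perfect matching. *)
Lemma singular_on_matching S : acyclic_on S ->
  singular_on F a S <-> ~ matching_on S.
Proof.
have [n] := ubnP #|S|; elim: n S => // n IH S ltS ac.
have [->|S0] := eqVneq S set0.
  split=> [[x [_ [u]]]|nm]; first by rewrite inE.
  by case: nm; exists id => u; rewrite inE.
have [u uS deg] := ac S (subxx _) S0.
have [/existsP[w /andP[wS auw]]|no] := boolP [exists w, (w \in S) && a u w]; last first.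
  have nou w : w \in S -> a u w = false.
    by move=> wS; apply/negP => auw; case/existsP: no; exists w; rewrite wS.
  split=> _.
    by case=> f /(_ _ uS)[fS]; rewrite nou.
  exists (fun w => (w == u)%:R); split; last by exists u; rewrite ?eqxx ?oner_eq0.
  move=> w wS; apply: adjsum_eq0 => t tS awt; case: eqP awt => // ->.
  by rewrite aC nou.
have uniq_w t : t \in S -> a u t -> t = w.
  by move=> tS aut; apply: (card_le1_eqP deg); rewrite !inE ?tS ?wS.
have wu : w != u by apply: contraTneq auw => ->; rewrite aI.
pose S' := S :\ u :\ w.
have S'S : S' \subset S by apply: subset_trans (subsetDl _ _) (subsetDl _ _).
have S'E t : (t \in S') = [&& t != w, t != u & t \in S] by rewrite !inE.
have ltS' : (#|S'| < n)%N.
  move: ltS; rewrite (cardsD1 u S) uS (cardsD1 w (S :\ u)) !inE wu wS /= -/S'.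
  by rewrite add1n ltnS => /ltnW.
have := IH S' ltS' (acyclic_on_sub S'S ac).
have -> : singular_on F a S <-> singular_on F a S'.
  have dec x t : adjsum a S x t =
      (a t u)%:R * x u + ((a t w)%:R * x w + adjsum a S' x t).
    rewrite /adjsum (bigD1 u) //= (bigD1 w) /= ?wS ?wu //.
    congr (_ + (_ + _)); apply: eq_bigl => i.
    by rewrite S'E; case: (i \in S); rewrite ?andbF ?andbT /= 1?andbC.
  have uS' x : adjsum a S' x u = 0.
    apply: adjsum_eq0 => t; rewrite S'E => /and3P[tw _ tS] aut.
    by rewrite (uniq_w t) // eqxx in tw.
  have auS' t : t \in S' -> a t u = false.
    rewrite S'E => /and3P[tw _ tS]; apply/negP; rewrite aC => aut.
    by rewrite (uniq_w t) // eqxx in tw.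
  split=> [[x [x0 [t tS xt]]]|[x [x0 [t tS xt]]]].
    (* This is the equation at the leaf [u], whose only neighbour is [w]. *)
    have xw : x w = 0.
      by have := x0 u uS; rewrite dec uS' aI auw mul0r add0r mul1r addr0.
    have xS' : null_on a S' x.
      move=> s sS'; rewrite -[RHS](x0 s (subsetP S'S _ sS')) dec auS' // xw.
      by rewrite mul0r mulr0 !add0r.
    exists x; split=> //.
    have [tw|tw] := eqVneq t w; first by rewrite tw xw eqxx in xt.
    have [tu|tu] := eqVneq t u; last by exists t; rewrite // S'E tw tu.
    (* If [x] vanished on [S'], the equation at [w] would reduce to [x u = 0]. *)
    apply: contrapT => no; move: xt; rewrite tu => /eqP; apply.
    have := x0 w wS; rewrite dec aI mul0r add0r aC auw mul1r => e.
    rewrite -[RHS]e adjsum_eq0 ?addr0 // => s sS' _.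
    by apply/eqP/negPn/negP => xs; apply: no; exists s.
  (* The value at [u] is chosen to satisfy the equation at [w]; the value 0 at [w] satisfies the one
     at [u] and leaves those on [S'] intact. *)
  pose x' s := if s == u then - adjsum a S' x w else if s == w then 0 else x s.
  have x'S s : s \in S' -> x' s = x s.
    by rewrite S'E /x' => /and3P[/negbTE -> /negbTE ->].
  exists x'; split; last by exists t; rewrite ?x'S ?(subsetP S'S).
  have x'w : x' w = 0 by rewrite /x' eqxx (negbTE wu).
  move=> s sS; rewrite dec x'w mulr0 add0r (eq_adjsum a s x'S).
  have [->|su] := eqVneq s u; first by rewrite aI mul0r add0r uS'.
  have [->|sw] := eqVneq s w; first by rewrite aC auw mul1r /x' eqxx addNr.
  have sS' : s \in S' by rewrite S'E sw su.
  by rewrite auS' // mul0r add0r x0.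
suff -> : matching_on S <-> matching_on S' by [].
split=> -[f fP].
  have fu : f u = w by have [fS afu _] := fP u uS; exact: uniq_w.
  have fw : f w = u by have [_ _] := fP u uS; rewrite fu.
  exists f => t; rewrite S'E => /and3P[tw tu tS]; have [fS aft fft] := fP t tS.
  split=> //; rewrite S'E fS andbT; apply/andP; split; apply/eqP => e.
    by rewrite -fft e fw eqxx in tu.
  by rewrite -fft e fu eqxx in tw.
exists (fun t => if t == u then w else if t == w then u else f t) => t tS.
have [->|tu] := eqVneq t u; first by rewrite (negbTE wu) eqxx.
have [->|tw] := eqVneq t w; first by rewrite eqxx aC.
have tS' : t \in S' by rewrite S'E tw tu.
have [] := fP t tS'; rewrite S'E => /and3P[fw fu fS] -> ->.
by rewrite (negbTE fw) (negbTE fu).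
Qed.

End Acyclic.

(** * Sets closed under adjacency *)

Section Closed.
Variables (F : fieldType) (T : finType) (a : rel T).

Lemma adjsum_closed (S K : {set T}) (x : T -> F) u : K \subset S -> u \in K ->
  (forall u w, u \in K -> w \in S -> a u w -> w \in K) ->
  adjsum a S x u = adjsum a K x u.
Proof.
move=> KS uK cl; rewrite (adjsum_setD _ _ _ KS) [X in _ + X]adjsum_eq0 ?addr0 // => w.
by rewrite inE => /andP[wK wS] /(cl _ _ uK wS); rewrite (negbTE wK).
Qed.

Lemma singular_on_of_closed (S K : {set T}) : symmetric a -> K \subset S ->
  (forall u w, u \in K -> w \in S -> a u w -> w \in K) ->
  singular_on F a K -> singular_on F a S.
Proof.
move=> aC KS cl [x [x0 [u uK xu]]].
pose x' w := if w \in K then x w else 0.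
have x'K w : w \in K -> x' w = x w by rewrite /x' => ->.
exists x'; split; last by exists u; rewrite ?x'K ?(subsetP KS).
move=> w wS; have [wK|wK] := boolP (w \in K).
  by rewrite (adjsum_closed _ KS wK cl) (eq_adjsum a w x'K) x0.
apply: adjsum_eq0 => t tS awt; rewrite /x'; case: ifP => // tK.
by rewrite (cl t w) // 1?aC in wK.
Qed.

End Closed.

(** * Cycles *)

Lemma next_nth_modn (T : eqType) (x0 : T) (c : seq T) i :
  uniq c -> (i < size c)%N -> next c (nth x0 c i) = nth x0 c (i.+1 %% size c).
Proof.
move=> c_uniq ic; rewrite next_nth mem_nth // index_uniq //.
case: c {c_uniq} ic => //= y p; rewrite ltnS leq_eqVlt.
(* At the last index the lookup in the tail is out of range, and its default is the head [y], as the
   wrap-around requires. *)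
case/orP=> [/eqP ->|lt]; first by rewrite modnn nth_default.
by rewrite modn_small ?ltnS //=; apply: set_nth_default.
Qed.

Section Cycle.
Variables (F : numFieldType) (T : finType) (a : rel T) (x0 : T) (c : seq T).
Hypotheses (c_uniq : uniq c) (c_size : (3 <= size c)%N).
Hypothesis aE : {in c &, forall u w, a u w = (w == next c u) || (u == next c w)}.

Let n := size c.
Let nx i := nth x0 c (i %% n).

Let n_gt0 : (0 < n)%N.
Proof. exact: leq_trans c_size. Qed.

Let nx_mem i : nx i \in c.
Proof. by rewrite mem_nth // ltn_mod. Qed.

Let nx_eq i j : (nx i == nx j) = (i == j %[mod n]).
Proof. by rewrite nth_uniq // ltn_mod. Qed.

Let nxP u : u \in c -> exists i, u = nx i.
Proof.
move=> uc; exists (index u c).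
by rewrite /nx modn_small ?index_mem // nth_index.
Qed.

Let next_nx i : next c (nx i) = nx i.+1.
Proof.
by rewrite next_nth_modn ?ltn_mod // /nx -[in LHS]addn1 modnDml addn1.
Qed.

Lemma adjsum_cycle (x : T -> F) i :
  adjsum a [set w in c] x (nx i.+1) = x (nx i) + x (nx i.+2).
Proof.
rewrite /adjsum (bigD1 (nx i)) ?inE ?nx_mem //= aE ?nx_mem // !next_nx eqxx orbT mul1r.
(* The two neighbours are distinct because the length is at least 3. *)
rewrite (bigD1 (nx i.+2)) /=; last first.
  rewrite inE nx_mem nx_eq -addn2 -[X in _ != X %[mod _]]addn0 eqn_modDl mod0n.
  by rewrite modn_small.
rewrite aE ?nx_mem // next_nx eqxx mul1r big1 ?addr0 // => w; rewrite inE => /andP[/andP[wc wi] wi2].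
rewrite aE ?nx_mem // next_nx (negbTE wi2) /=; have [j wE] := nxP wc.
rewrite wE next_nx nx_eq -[i.+1]addn1 -[j.+1]addn1 eqn_modDr eq_sym -nx_eq -wE.
by rewrite (negbTE wi) mul0r.
Qed.

Lemma null_on_cycle (x : T -> F) : null_on a [set w in c] x <->
  forall i, x (nx i.+2) = - x (nx i).
Proof.
split=> [x_null i | xE u].
  have := x_null (nx i.+1); rewrite inE nx_mem adjsum_cycle => /(_ isT)/eqP.
  by rewrite addrC addr_eq0 => /eqP.
rewrite inE => /nxP[i ->].
(* Modulo [n] every index is a successor, as [adjsum_cycle] requires. *)
have -> : nx i = nx (i + n.-1).+1.
  by apply/eqP; rewrite nx_eq -addnS prednK // modnDr.
by rewrite adjsum_cycle xE addrN.
Qed.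

(** Null vectors change sign at every second step. If an odd number of double steps closes up, each
    entry equals its opposite and is 0; such a number exists exactly when 4 does not divide the
    length. *)
Lemma singular_on_cycle : singular_on F a [set w in c] <-> (4 %| size c)%N.
Proof.
split=> [[x [/null_on_cycle xE [u]]]|n4].
  rewrite inE => /nxP[i ->] xi; apply/negPn/negP => n4.
  have iter k : x (nx (i + k.*2)) = (-1) ^+ k * x (nx i).
    elim: k => [|k IH]; first by rewrite addn0 mul1r.
    by rewrite doubleS !addnS xE IH exprS mulN1r mulNr.
  (* Take [n] itself when it is odd, and its half when it is even but not a multiple of 4. *)
  have [k kodd kn] : exists2 k, odd k & (n %| k.*2)%N.
    have [no|ne] := boolP (odd n); first by exists n; rewrite // -muln2 dvdn_mulr.
    exists n./2; last by rewrite halfK (negbTE ne) subn0.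
    apply: contraNT n4 => ho.
    rewrite -/n -(odd_double_half n) (negbTE ne) add0n -(odd_double_half n./2) (negbTE ho).
    by rewrite add0n -!muln2 -mulnA dvdn_mull.
  have := iter k; rewrite -signr_odd kodd mulN1r.
  have -> : nx (i + k.*2) = nx i.
    by apply/eqP; rewrite nx_eq -[X in _ == X %[mod _]]addn0 eqn_modDl mod0n -/(dvdn _ _).
  by move=> /eqP; rewrite -subr_eq0 opprK -mulr2n mulrn_eq0 (negbTE xi).
(* The pattern 1, 0, -1, 0 of period 4, which fits on the cycle when 4 divides [n]. *)
pose g j : F := if odd j then 0 else (-1) ^+ j./2.
have g2 j : g j.+2 = - g j.
  by rewrite /g /= negbK; case: ifP; rewrite ?oppr0 // exprS mulN1r.
have g4 m j : g (m * 4 + j)%N = g j.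
  by elim: m => // m IH; rewrite mulSn -addnA /= !addSn add0n !g2 opprK.
have gn j : g (j %% n)%N = g j.
  rewrite [in RHS](divn_eq j n) -/n; case/dvdnP: n4 => m; rewrite -/n => ->.
  by rewrite mulnA g4.
exists (fun w => g (index w c)); split.
  by apply/null_on_cycle => i; rewrite /nx !index_uniq ?ltn_mod // !gn g2.
by exists (nx 0); rewrite ?inE ?nx_mem // index_uniq ?ltn_mod // gn oner_eq0.
Qed.

Lemma next_next_neq u : u \in c -> next c (next c u) != u.
Proof.
move=> /nxP[i ->]; rewrite !next_nx nx_eq -addn2 -[X in _ == X %[mod _]]addn0.
by rewrite eqn_modDl mod0n modn_small.
Qed.

End Cycle.

(** * Graphs *)

Section GraphLemmas.
Variable T : finType.
Implicit Types (G H K C : graph T) (S : {set T}) (u v w : T).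

Lemma edges_vertices G f : f \in edges G -> f \subset vertices G.
Proof. by move=> fG; have /andP[] := forall_inP (edgesP G) f fG. Qed.

Lemma edges_card G f : f \in edges G -> #|f| = 2.
Proof. by move=> fG; have /andP[_ /eqP] := forall_inP (edgesP G) f fG. Qed.

Lemma adj_sym G : symmetric (adj G).
Proof. by move=> u v; rewrite /adj /= setUC. Qed.

Lemma adj_irr G : irreflexive (adj G).
Proof.
by move=> u; apply/negP => /edges_card; rewrite setUid cards1.
Qed.

Lemma adj_vertices G u v : adj G u v -> u \in vertices G /\ v \in vertices G.
Proof.
by move=> /edges_vertices/subsetP s; split; apply: s; rewrite !inE eqxx ?orbT.
Qed.

Lemma graph_eq G H : subgraph G H -> subgraph H G -> G = H.
Proof.
case: G H => [VG EG gP] [VH EH hP] /andP[/= vGH eGH] /andP[/= vHG eHG].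
have eV : VG = VH by apply/eqP; rewrite eqEsubset vGH.
have eE : EG = EH by apply/eqP; rewrite eqEsubset eGH.
by case: VH / eV hP {vGH vHG}; case: EH / eE {eGH eHG} => hP; congr Graph; apply: bool_irrelevance.
Qed.

Lemma subgraph_adj H G u v : subgraph H G -> adj H u v -> adj G u v.
Proof. by case/andP=> _ /subsetP; apply. Qed.

Lemma vertices_induced G S : S \subset vertices G -> vertices (induced G S) = S.
Proof. by move=> /setIidPr. Qed.

Lemma adj_induced G S u v :
  adj (induced G S) u v = [&& adj G u v, u \in S & v \in S].
Proof. by rewrite /adj /= inE subUset !sub1set. Qed.

Lemma induced_subgraph G S : subgraph (induced G S) G.
Proof.
rewrite /subgraph /= subsetIl /=; apply/subsetP => f.
by rewrite inE => /andP[].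
Qed.

Lemma path_induced G S u p : path (adj (induced G S)) u p -> {subset p <= S}.
Proof.
elim: p u => //= y p IH x /andP[+ /IH pS] r.
by rewrite adj_induced inE => /and3P[_ _ yS] /orP[/eqP ->|/pS].
Qed.

Lemma connect_adj_sym G : connect_sym (adj G).
Proof. exact/sym_connect_sym/adj_sym. Qed.

Lemma connected_graph_star G u : u \in vertices G ->
  (forall w, w \in vertices G -> connect (adj G) u w) -> connected_graph G.
Proof.
move=> uG con; apply/andP; split; first by apply/set0Pn; exists u.
apply/forall_inP => x xG; apply/forall_inP => y yG.
by apply: connect_trans (con y yG); rewrite connect_adj_sym con.
Qed.

Lemma connected_graphP G u w : connected_graph G ->
  u \in vertices G -> w \in vertices G -> connect (adj G) u w.
Proof. by case/andP=> _ /forall_inP con /con /forall_inP; apply. Qed.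

Lemma connect_subgraph H G u v : subgraph H G ->
  connect (adj H) u v -> connect (adj G) u v.
Proof.
by move=> HG; apply: connect_sub => x y /(subgraph_adj HG)/connect1.
Qed.

Lemma connected_graph_add H K u w : connected_graph K -> subgraph K H ->
  vertices H \subset w |: vertices K -> u \in vertices K -> adj H u w ->
  connected_graph H.
Proof.
move=> conK KH sHK uK auw; apply: (@connected_graph_star _ u).
  by have [] := adj_vertices auw.
move=> x /(subsetP sHK); rewrite !inE => /orP[/eqP ->|xK]; first exact: connect1.
exact/(connect_subgraph KH)/connected_graphP.
Qed.

Lemma has_perfect_matchingP G :
  has_perfect_matching G <-> matching_on (adj G) (vertices G).
Proof.
split=> [[M [ME tM cM]]|[f fP]].
  (* The partner of [u] is the other element of its block; the default [u] is never reached on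
     vertices of [G]. *)
  exists (fun u => odflt u [pick w in pblock M u | w != u]).
  have blockP u w : u \in vertices G -> w \in pblock M u -> w != u ->
      pblock M u = [set u; w].
    move=> uG wB wu; have uM : u \in cover M by rewrite cM.
    apply/esym/eqP; rewrite eqEcard subUset !sub1set wB mem_pblock uM /=.
    by rewrite cards2 eq_sym wu (edges_card (subsetP ME _ (pblock_mem uM))).
  move=> u uG; have uM : u \in cover M by rewrite cM.
  have BM := pblock_mem uM; have BE := subsetP ME _ BM.
  case: pickP => [w /andP[wB wu]|no] /=; last first.
    have := edges_card BE; rewrite (_ : pblock M u = [set u]) ?cards1 //.
    apply/setP => w; rewrite inE; apply/idP/eqP => [wB|->].
      by have := no w; rewrite wB /= => /negbFE/eqP.
    by rewrite mem_pblock.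
  have eB := blockP _ _ uG wB wu; have auw : adj G u w by rewrite /adj /= -eB.
  have [_ wG] := adj_vertices auw; split=> //.
  have eBw : pblock M w = [set u; w] by rewrite -eB; apply: def_pblock.
  rewrite eBw; case: pickP => [t|/(_ u)] /=; last first.
    by rewrite !inE eqxx eq_sym wu.
  by rewrite !inE => /andP[/orP[/eqP -> //|->]].
exists [set [set u; f u] | u in vertices G].
have blockE u t : u \in vertices G -> t \in [set u; f u] -> [set u; f u] = [set t; f t].
  move=> uG; have [_ _ ffu] := fP u uG.
  by rewrite !inE => /orP[] /eqP -> //; rewrite ffu setUC.
split.
- by apply/subsetP => _ /imsetP[u uG ->]; have [] := fP u uG.
- apply/trivIsetP => _ _ /imsetP[u uG ->] /imsetP[w wG ->] neq.
  rewrite -setI_eq0; apply: contraNT neq => /set0Pn[t /setIP[tu tw]].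
  by rewrite (blockE _ _ uG tu) (blockE _ _ wG tw).
- apply/setP => t; apply/bigcupP/idP => [[_ /imsetP[u uG ->]]|tG].
    by have [fu _ _] := fP u uG; rewrite !inE => /orP[] /eqP ->.
  by exists [set t; f t]; [apply: imset_f | rewrite set21].
Qed.

Lemma has_perfect_matching_induced G S : S \subset vertices G ->
  has_perfect_matching (induced G S) <-> matching_on (adj G) S.
Proof.
move=> SG; rewrite has_perfect_matchingP vertices_induced //.
split=> -[f fP]; exists f => u uS; have [fS afu ffu] := fP u uS; split=> //.
  by move: afu; rewrite adj_induced => /and3P[].
by rewrite adj_induced afu uS.
Qed.

Lemma ucycle_cycle_of G c : uniq c -> (3 <= size c)%N -> cycle (adj G) c ->
  exists2 C, cycle_of C G & vertices C = [set x in c].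
Proof.
move=> cu c3 cyc.
have aN x : x \in c -> adj G x (next c x) by exact: next_cycle.
have eP : [forall f in [set [set x; next c x] | x in c],
    (f \subset [set x in c]) && (#|f| == 2)].
  apply/forall_inP => _ /imsetP[x xc ->].
  by rewrite (edges_card (aN x xc)) andbT subUset !sub1set !inE mem_next xc.
exists (Graph eP) => //; split; first by exists c.
apply/andP; split; apply/subsetP => f /=.
  by rewrite inE => /aN/adj_vertices[].
by case/imsetP=> x /aN + ->.
Qed.

End GraphLemmas.

(** * Graphs with a unique cycle *)

Section UniqueCycle.
Variables (T : finType) (G C : graph T).
Hypotheses (hC : cycle_of C G) (C_unique : forall C', cycle_of C' G -> C = C').
Implicit Types (S : {set T}) (u v w : T) (c : seq T).

(** The form in which uniqueness of the cycle is used below: any closed walk without repetition, of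
    length at least 3, visits exactly the vertices of [C]. *)
Lemma ucycle_vertices c : uniq c -> (3 <= size c)%N -> cycle (adj G) c ->
  c =i vertices C.
Proof.
move=> cu c3 cyc x; have [C' /C_unique -> ->] := ucycle_cycle_of cu c3 cyc.
by rewrite inE.
Qed.

(** Otherwise some subset has minimum degree at least 2. A path in it then extends at its start
    forever: if both neighbours of the start lay on the path, one of them would close a cycle
    missing [v]. *)
Lemma acyclic_on_avoiding S v : v \in vertices C -> v \notin S ->
  acyclic_on (adj G) S.
Proof.
move=> vC vS S' S'S /set0Pn[s0 s0S']; apply: contrapT => no.
have deg u : u \in S' -> (1 < #|[set w in S' | adj G u w]|)%N.
  by move=> uS; rewrite ltnNge; apply/negP => du; apply: no; exists u.
have noc c : uniq c -> (3 <= size c)%N -> cycle (adj G) c -> {subset c <= S'} -> False.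
  move=> cu c3 cyc cS; have := ucycle_vertices cu c3 cyc v; rewrite vC => /cS vS'.
  by rewrite (subsetP S'S) in vS.
suff long n : exists x p,
    [/\ size p = n, uniq (x :: p), path (adj G) x p & {subset x :: p <= S'}].
  have [x [p [sp up _ _]]] := long #|T|.
  by have := uniq_leq_size up (fun y _ => mem_enum T y); rewrite -cardE /= sp ltnn.
elim: n => [|n [x [p [sp up pp pS]]]].
  by exists s0, [::]; split=> // y; rewrite inE => /eqP ->.
have xS : x \in S' by apply: pS; rewrite mem_head.
have /card_gt1P[y [z []]] := deg x xS.
rewrite !inE => /andP[yS axy] /andP[zS axz] yz.
have ext t : t \in S' -> adj G x t -> t \notin x :: p ->
    exists x p, [/\ size p = n.+1, uniq (x :: p), path (adj G) x p & {subset x :: p <= S'}].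
  move=> tS axt tp; exists t, (x :: p); split=> //=; rewrite ?sp //.
  - by move: tp up => /= -> ->.
  - by rewrite adj_sym axt.
  - by move=> r; rewrite inE => /orP[/eqP -> //|/pS].
(* A neighbour of [x] on the path, other than the vertex following [x], closes a cycle of length at
   least 3. *)
have back t : t \in S' -> adj G x t -> t \in x :: p -> t != head x p -> False.
  move=> tS axt; rewrite inE => /orP[/eqP tx|tp] th.
    by rewrite tx adj_irr in axt.
  case/splitPr: p / tp sp up pp pS th {ext} => -[|h p1] p2 sp up pp pS th.
    by rewrite /= eqxx in th.
  apply: (noc (x :: rcons (h :: p1) t)).
  - by move: up; rewrite -cat_rcons -cat_cons cat_uniq => /and3P[].
  - by rewrite /= size_rcons.
  - rewrite /cycle rcons_path last_rcons [adj _ _ x]adj_sym axt andbT.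
    by move: pp; rewrite -cat_rcons cat_path => /andP[].
  - move=> r rc; apply: pS; rewrite -cat_rcons -cat_cons mem_cat.
    by rewrite -(rcons_cons x) /= in rc *; rewrite rc.
have [yp|yp] := boolP (y \in x :: p); last exact: ext yp.
have [zp|zp] := boolP (z \in x :: p); last exact: ext zp.
exfalso; have [yh|yh] := eqVneq y (head x p); last exact: back yh.
by apply: (back z) => //; rewrite -yh eq_sym.
Qed.

Lemma cycle_seqP : exists c,
  [/\ uniq c, (3 <= size c)%N, c =i vertices C, cycle (adj G) c &
      edges C = [set [set x; next c x] | x in c]].
Proof.
case: hC => -[c [cu c3 vC eC]] CG; exists c; split=> //.
  by move=> x; rewrite vC inE.
apply: cycle_from_next => // x xc; apply: (subgraph_adj CG).
by rewrite /adj /= eC; apply: (imset_f (fun x => [set x; next c x])).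
Qed.

(** A chord would short-circuit [c] into a cycle missing some vertex of [C]. *)
Lemma chordless c : uniq c -> (3 <= size c)%N -> c =i vertices C ->
  cycle (adj G) c ->
  {in c &, forall u w, adj G u w = (w == next c u) || (u == next c w)}.
Proof.
move=> cu c3 vC cyc u w uc wc; apply/idP/orP; last first.
  by case=> /eqP ->; [|rewrite adj_sym]; apply: next_cycle.
move=> auw; have [i c' def_c] := rot_to uc.
have cu' : uniq (u :: c') by rewrite -def_c rot_uniq.
have cyc' : cycle (adj G) (u :: c') by rewrite -def_c rot_cycle.
have nE := next_rot i cu; rewrite def_c in nE.
have mE : u :: c' =i c by move=> x; rewrite -def_c mem_rot.
have : w \in c'.
  have := mE w; rewrite wc inE => /orP[/eqP wu|//].
  by rewrite wu adj_irr in auw.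
move=> wc'; case/splitPr: c' / wc' def_c cu' cyc' nE mE => c1 c2 def_c cu' cyc' nE mE.
(* If nothing follows [w], it precedes [u] on the cycle. Otherwise the edge from [u] to [w] bypasses
   [c1], which must then be empty. *)
case: c2 => [|y c2] in def_c cu' cyc' nE mE *.
  right; rewrite -nE cats1 -rcons_cons -(next_rotr 1) ?rotr1_rcons /= ?eqxx //.
  by rewrite -cats1.
have e : u :: w :: y :: c2 =i vertices C.
  apply: ucycle_vertices => //.
    move: cu'; rewrite !cons_uniq mem_cat negb_or cat_uniq => /andP[/andP[_ ->]].
    by case/and3P.
  move: cyc'; rewrite /cycle /= rcons_cat cat_path /= => /andP[_ /and3P[_ -> ->]].
  by rewrite auw.
left; rewrite -nE; case: c1 => [|t c1] in def_c cu' cyc' nE mE *.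
  by rewrite /= eqxx.
have : t \in u :: w :: y :: c2 by rewrite e -vC -mE !inE eqxx orbT.
rewrite inE => /orP[/eqP tu|tc].
  by move: cu'; rewrite tu /= mem_head.
by move: cu' => /= /and3P[_ + _]; rewrite mem_cat tc orbT.
Qed.

(** Two vertices give the same edge only if each is the successor of the other, which length at
    least 3 excludes. *)
Lemma card_edges_cycle c : uniq c -> (3 <= size c)%N ->
  edges C = [set [set x; next c x] | x in c] -> #|edges C| = size c.
Proof.
move=> cu c3 ->; rewrite card_in_imset; first exact/card_uniqP.
move=> x y xc yc exy; have : x \in [set y; next c y] by rewrite -exy set21.
rewrite !inE => /orP[/eqP //|/eqP ex].
have : y \in [set x; next c x] by rewrite exy set21.
rewrite !inE => /orP[/eqP //|/eqP ey].
by have := next_next_neq x cu c3 xc; rewrite -ey -ex eqxx.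
Qed.

Definition pendant_set v : {set T} :=
  [arg max_(S > [set v] |
     [&& S \subset vertices G, connected_graph (induced G S) &
         S :&: vertices C == [set v]]) #|S|].

(** The last clause says that the pendant tree is joined to the rest only by the cycle edges at
    [v]. *)
Lemma pendant_setP v : v \in vertices C ->
  [/\ pendant_set v \subset vertices G,
      connected_graph (induced G (pendant_set v)),
      pendant_set v :&: vertices C = [set v] &
      forall u w, u \in pendant_set v -> w \in vertices G :\: pendant_set v ->
        adj G u w -> u = v /\ w \in vertices C].
Proof.
move=> vC; have vG : v \in vertices G.
  by case: hC => _ /andP[/subsetP + _]; apply.
have ok : [&& [set v] \subset vertices G, connected_graph (induced G [set v]) &
    [set v] :&: vertices C == [set v]].
  rewrite sub1set vG (setIidPl _) ?sub1set // eqxx andbT /=.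
  apply: (@connected_graph_star _ _ v); rewrite vertices_induced ?sub1set ?inE //.
  by move=> w; rewrite inE => /eqP ->; apply: connect0.
rewrite /pendant_set; case: arg_maxnP => // P /and3P[PG conP /eqP PC] Pmax.
have vP : v \in P by have /setP/(_ v) := PC; rewrite !inE eqxx => /andP[].
split=> // u w uP; rewrite inE => /andP[wP wG] auw.
have wC : w \in vertices C.
  (* Off the cycle, [w] could be added to [P], against maximality. *)
  apply: contraT => wC; have: (#|w |: P| <= #|P|)%N.
    apply: Pmax; have wPG : w |: P \subset vertices G by rewrite subUset sub1set wG.
    rewrite wPG setIUl PC (_ : [set w] :&: _ = set0) ?set0U ?eqxx ?andbT /=; last first.
      by apply/setP => x; rewrite !inE; apply/andP => -[/eqP ->]; apply/negP.
    apply: (@connected_graph_add _ _ (induced G P) u w) => //.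
    - rewrite /subgraph !vertices_induced // subsetUr /=; apply/subsetP => f.
      rewrite !inE => /andP[-> fP] /=; exact: subset_trans fP (subsetUr _ _).
    - by rewrite !vertices_induced.
    - by rewrite vertices_induced.
    - by rewrite adj_induced auw !inE eqxx uP orbT.
  by rewrite cardsU1 wP ltnn.
split=> //; apply/eqP/negPn/negP => uv.
have [c [cu c3 cC cyc _]] := cycle_seqP.
have vc : v \in c by rewrite cC.
have [i c' def_c] := rot_to vc.
have cu' : uniq (v :: c') by rewrite -def_c rot_uniq.
have cyc' : cycle (adj G) (v :: c') by rewrite -def_c rot_cycle.
have mE : v :: c' =i vertices C by move=> x; rewrite -cC -def_c mem_rot.
have : w \in c'.
  have := mE w; rewrite wC inE => /orP[/eqP wv|//].
  by rewrite wv vP in wP.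
move=> wc'; case/splitPr: c' / wc' def_c cu' cyc' mE => c1 c2 def_c cu' cyc' mE.
have /connectP[p0 pp0 lp0] : connect (adj (induced G P)) v u.
  by apply: connected_graphP conP _ _; rewrite vertices_induced.
case/shortenP: pp0 lp0 => p pp pu _ lp.
have pP := path_induced pp.
(* If [u] differed from [v], a path in [P] from [v] to [u], the edge to [w] and the arc of the cycle
   back to [v] would form a cycle through [u]. Then [u] would be a second vertex of [P] on [C]. *)
have e : v :: p ++ w :: c2 =i vertices C.
  apply: ucycle_vertices.
  - have [_ _ u2] := and3P (etrans (esym (cat_uniq (v :: c1) _)) cu').
    rewrite -cat_cons cat_uniq pu u2 andbT.
    apply/hasPn => t tc; apply/negP => tp.
    have tP : t \in P by move: tp; rewrite inE => /orP[/eqP ->|/pP].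
    have tC : t \in vertices C by rewrite -mE inE mem_cat tc !orbT.
    have tv : t = v.
      by apply/eqP; have /setP/(_ t) := PC; rewrite !inE tP tC.
    by move: cu'; rewrite /= mem_cat -tv tc orbT.
  - case: p lp {pp pu pP} => [|y p] /= lp; first by rewrite lp eqxx in uv.
    by rewrite size_cat /= addnS !ltnS.
  - move: cyc'; rewrite /cycle !rcons_cat !cat_path -lp => /andP[_ /= /andP[_ ->]].
    rewrite auw /= andbT; apply: sub_path pp => x y.
    exact/subgraph_adj/induced_subgraph.
have uC : u \in vertices C.
  by rewrite -e lp -cat_cons mem_cat mem_last.
by have /setP/(_ u) := PC; rewrite !inE uP uC (negbTE uv).
Qed.

End UniqueCycle.

(** * Singular graphs *)

Section Spectral.
Variables (R : realType) (T : finType).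
Implicit Types (G H K C : graph T) (S : {set T}) (u v w : T).

Lemma singular_graphP G :
  singular_graph R G <-> singular_on R (adj G) (vertices G).
Proof. exact: adjmx_singularP. Qed.

Lemma null_on_induced G S (x : T -> R) :
  null_on (adj (induced G S)) S x <-> null_on (adj G) S x.
Proof.
have e u : u \in S -> adjsum (adj (induced G S)) S x u = adjsum (adj G) S x u.
  by move=> uS; apply: eq_bigr => w wS; rewrite adj_induced uS wS !andbT.
by split=> x0 u uS; have := x0 u uS; rewrite e.
Qed.

Lemma in_supportP G S v : S \subset vertices G -> v \in S ->
  in_support R (induced G S) v <-> support_on R (adj G) S v.
Proof.
move=> SG vS; have vI : v \in vertices (induced G S) by rewrite vertices_induced.
apply: (iff_trans (adjmx_supportP _ _ vI)); rewrite vertices_induced //.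
by split=> -[x /null_on_induced x0 xv]; exists x.
Qed.

(** Both claims follow from maximality: neither a missing edge inside [K] nor an adjacent vertex
    outside it can be left to add. *)
Lemma component_closed H K : is_component K H ->
  K = induced H (vertices K) /\
  forall u w, u \in vertices K -> w \in vertices H -> adj H u w -> w \in vertices K.
Proof.
move=> [KH conK Kmax]; have /andP[vKH eKH] := KH.
have sub S : vertices K \subset S -> S \subset vertices H -> subgraph K (induced H S).
  move=> KS SH; rewrite /subgraph vertices_induced // KS; apply/subsetP => f fK.
  by rewrite inE (subsetP eKH) // (subset_trans (edges_vertices fK)).
split=> [|u w uK wH auw].
  apply/esym/Kmax; [exact: induced_subgraph | | exact: sub].
  have /andP[/set0Pn[u uK] _] := conK.
  apply: (@connected_graph_star _ _ u); rewrite vertices_induced // => w wK.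
  by apply: connect_subgraph (connected_graphP conK uK wK); apply: sub.
have SH : w |: vertices K \subset vertices H by rewrite subUset sub1set wH.
have <- : induced H (w |: vertices K) = K.
  apply: Kmax; [exact: induced_subgraph | | exact: sub (subsetUr _ _) SH].
  apply: (connected_graph_add conK (sub _ (subsetUr _ _) SH) _ uK (w := w)).
    by rewrite vertices_induced.
  by rewrite adj_induced auw !inE eqxx uK orbT.
by rewrite vertices_induced // setU11.
Qed.

Lemma component_of_vertex H u : u \in vertices H ->
  is_component (induced H [set w in vertices H | connect (adj H) u w]) H.
Proof.
move=> uH; set S := [set w in _ | _].
have SH : S \subset vertices H by apply/subsetP => w; rewrite inE => /andP[].
have uS : u \in S by rewrite inE uH connect0.
split=> [||H' H'H conH' KH']; first exact: induced_subgraph.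
  apply: (@connected_graph_star _ _ u); rewrite vertices_induced // => w.
  rewrite inE => /andP[_ /connectP[p pp ->]] {w}.
  elim/last_ind: p pp => [|p w IH] //=; rewrite rcons_path last_rcons => /andP[pp aw].
  apply: connect_trans (IH pp) (connect1 _); rewrite adj_induced aw !inE /=.
  have [lH wH] := adj_vertices aw; rewrite lH wH /=.
  have cl : connect (adj H) u (last u p) by apply/connectP; exists p.
  by rewrite cl (connect_trans cl (connect1 aw)).
have sH' : vertices H' \subset S.
  apply/subsetP => w wH'; rewrite inE; have /andP[/subsetP vH' _] := H'H.
  rewrite vH' //=; apply: (connect_subgraph H'H); apply: connected_graphP => //.
  by have /andP[/subsetP + _] := KH'; apply; rewrite vertices_induced.
apply: graph_eq => //; rewrite /subgraph vertices_induced // sH' /=.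
apply/subsetP => f fH'; have /andP[_ /subsetP eH'] := H'H.
by rewrite inE eH' // (subset_trans (edges_vertices fH')).
Qed.

(** Null vectors restrict to components and extend from them by zero, so [H] is singular iff some
    component is; each component is acyclic, so the matching criterion applies to it. *)
Lemma component_matchingP H : acyclic_on (adj H) (vertices H) ->
  (exists K, is_component K H /\ ~ has_perfect_matching K) <->
  singular_on R (adj H) (vertices H).
Proof.
move=> ac.
have comp K : is_component K H -> vertices K \subset vertices H /\
    (~ has_perfect_matching K <-> singular_on R (adj H) (vertices K)).
  move=> hK; have [[/andP[KH _] _ _] [KE _]] := (hK, component_closed hK).
  split=> //; rewrite [in has_perfect_matching _]KE has_perfect_matching_induced //.
  have acK := acyclic_on_sub KH ac.
  by apply: iff_sym; apply: singular_on_matching acK; [exact: adj_sym | exact: adj_irr].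
split=> [[K [hK nK]]|[x [x0 [u uH xu]]]].
  have [KH KP] := comp K hK; have [_ cl] := component_closed hK.
  by apply: singular_on_of_closed (@adj_sym _ H) KH cl _; apply/KP.
have hK := component_of_vertex uH.
move: hK; set K := induced _ _ => hK; exists K; split=> //.
have [KH KP] := comp K hK; have [_ cl] := component_closed hK; apply/KP.
exists x; split=> [w wK|].
  by rewrite -(adjsum_closed _ KH wK cl) x0 // (subsetP KH).
exists u => //; rewrite /K vertices_induced ?inE ?uH ?connect0 //.
by apply/subsetP => w; rewrite inE => /andP[].
Qed.

Lemma acyclic_on_induced G S : acyclic_on (adj G) S -> acyclic_on (adj (induced G S)) S.
Proof.
move=> ac S' S'S S'0; have [u uS' d] := ac S' S'S S'0; exists u => //.
apply: leq_trans d; apply/subset_leq_card/subsetP => w.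
by rewrite !inE adj_induced => /and3P[-> ->].
Qed.

End Spectral.

Local Close Scope ring_scope.

Theorem theorem3p6 (R : realType) (T : finType) (G C : graph T)
    (hG : unicyclic G) (hC : cycle_of C G) (hGC : ~ is_cycle G) :
  singular_graph R G <->
  (exists v : T,
     [/\ v \in vertices C,
         ~ in_support R (pendant_tree G C v) v &
         ~ has_perfect_matching (pendant_tree G C v) \/
         ~ has_perfect_matching (delete G (pendant_tree G C v))])
  \/
  ((forall v : T, v \in vertices C -> in_support R (pendant_tree G C v) v) /\
   ((exists K : graph T,
       is_component K (delete G C) /\ ~ has_perfect_matching K) \/
    4 %| #|edges C|)).
Proof.
have C_unique C' : cycle_of C' G -> C = C'.
  by case: hG => _ [C0 [_ uC0]] hC'; rewrite -(uC0 _ hC) -(uC0 _ hC').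
have [aC aI] := (@adj_sym _ G, @adj_irr _ G).
pose P := pendant_set G C; pose V := vertices G.
have PP v vC := pendant_setP hC C_unique (v := v) vC.
have vP v : v \in vertices C -> v \in P v.
  by move=> /PP[_ _ /setP/(_ v)]; rewrite !inE eqxx => /andP[].
have supP v : v \in vertices C ->
    in_support R (pendant_tree G C v) v <-> support_on R (adj G) (P v) v.
  by move=> vC; have [PG _ _ _] := PP v vC; apply: in_supportP PG (vP v vC).
have CV : vertices C \subset V by case: hC => _ /andP[].
rewrite singular_graphP -/V.
(* A second cycle vertex lies outside [P v], so that [P v] avoids part of the cycle and is
   acyclic. *)
have otherC v : v \in vertices C -> exists2 w, w \in vertices C & w != v.
  move=> vC; have [c [cu c3 cC _ _]] := cycle_seqP hC.
  have vc : v \in c by rewrite cC.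
  exists (next c v); first by rewrite -cC mem_next.
  by apply/eqP => e; have := next_next_neq v cu c3 vc; rewrite !e eqxx.
have split_at v : v \in vertices C -> ~ in_support R (pendant_tree G C v) v ->
    singular_on R (adj G) V <->
    ~ has_perfect_matching (pendant_tree G C v) \/
    ~ has_perfect_matching (delete G (pendant_tree G C v)).
  move=> vC nsv; have [PG _ PC bd] := PP v vC.
  have [w wC wv] := otherC v vC.
  have acP : acyclic_on (adj G) (P v).
    apply: (acyclic_on_avoiding C_unique wC); apply: contra wv => wP.
    by have /setP/(_ w) := PC; rewrite !inE wP wC => <-.
  have acQ : acyclic_on (adj G) (V :\: P v).
    by apply: (acyclic_on_avoiding C_unique vC); rewrite inE vP.
  have [col colP] := acyclic_on_colouring aC aI acP.
  rewrite (singular_on_split_unsupported aC PG (vP v vC) _ colP); last first.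
  - by rewrite -supP.
  - by move=> u t uP tQ /(bd u t uP tQ)[].
  rewrite !(singular_on_matching R aC aI) //.
  rewrite /pendant_tree -/(pendant_set G C v) -/(P v) /delete vertices_induced //.
  by rewrite !has_perfect_matching_induced ?subsetDl.
have [[v vC nsv]|all] :=
  EM (exists2 v, v \in vertices C & ~ in_support R (pendant_tree G C v) v).
  rewrite (split_at v vC nsv); split=> [h|[[w [wC nsw h]]|[sup _]]].
  - by left; exists v.
  (* Condition (i) may hold at another vertex [w]; the criteria at [v] and at [w] are both
     equivalent to singularity of [G]. *)
  - by apply/(split_at v vC nsv)/(split_at w wC nsw).
  - by case: nsv; apply: sup.
have sup v : v \in vertices C -> in_support R (pendant_tree G C v) v.
  by move=> vC; apply: contrapT => nsv; apply: all; exists v.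
have [c [cu c3 cC cyc eC]] := cycle_seqP hC.
have cE : vertices C = [set x in c] by apply/setP => x; rewrite inE cC.
have aE := chordless C_unique cu c3 cC cyc.
rewrite (@singular_on_split_supported _ _ _ aC V (vertices C) P) //; first last.
- by move=> v vC; apply/supP => //; apply: sup.
- by move=> v u w vC; have [_ _ _] := PP v vC; apply.
- by move=> v /PP[].
- by move=> v /PP[].
have [v vC] : exists v, v \in vertices C.
  by case: (c) c3 cC => // v s _ sC; exists v; rewrite -sC mem_head.
rewrite cE (singular_on_cycle R v cu c3 aE) -cE (card_edges_cycle cu c3 eC).
have DV : V :\: vertices C \subset V by exact: subsetDl.
have DE : vertices (delete G C) = V :\: vertices C by exact: vertices_induced.
have acD : acyclic_on (adj (delete G C)) (vertices (delete G C)).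
  rewrite DE; apply: acyclic_on_induced.
  by apply: (acyclic_on_avoiding C_unique vC); rewrite inE vC.
rewrite (component_matchingP R acD) DE.
have -> : singular_on R (adj (delete G C)) (V :\: vertices C) <->
    singular_on R (adj G) (V :\: vertices C).
  by split=> -[x [/null_on_induced x0 xu]]; exists x.
split=> [h|[[w [wC /(_ (sup w wC))]]|[_ h]]] //; last by case: h; [right|left].
by right; split=> //; case: h; [right|left].
Qed.
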